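(* Let $\{R_m\}_{m\ge 0}$ be the Perrin sequence. The pair $(n,x)=(4,5)$ is the only pair such that $n$ is a non-negative integer, $x$ is a Perrin number (that is, $x=R_m$ for some integer $m\ge 0$), and $n!+1=x^{2}$.
   Context: The Perrin sequence $\{R_m\}_{m\ge 0}$ is defined by $R_0=3$, $R_1=0$, $R_2=2$ and $R_{m+3}=R_{m+1}+R_m$ for all $m\ge 0$. Its first terms are $3,0,2,3,2,5,5,7,10,12,17,22,\ldots$. Uniqueness refers to the pair $(n,x)$, not to the index $m$ (note that $5=R_5=R_6$). *)

(* Defs.v *)
From mathcomp Require Import all_boot.

(* Written with [as] so that the structural-recursion check accepts
   R_(k+3) = R_(k+1) + R_k. *)
Fixpoint perrin (m : nat) : nat :=
  match m with
  | 0 => 3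
  | 1 => 0
  | 2 => 2
  | ((k.+1 as k1).+2) => perrin k1 + perrin k
  end.

Lemma perrin_rec (m : nat) : perrin m.+3 = perrin m.+1 + perrin m.
Proof. by []. Qed.

Example perrin_first_terms :
  [seq perrin m | m <- iota 0 12] = [:: 3; 0; 2; 3; 2; 5; 5; 7; 10; 12; 17; 22].
Proof. by []. Qed.

Definition is_perrin (x : nat) : Prop := exists m : nat, x = perrin m.

(* Main.v *)
(** Extend the Perrin sequence to negative indices: R_k = 1 or -1 for
    k = -29, -11, -7, -2, -1.  If x^3 = x + 1 then x^13 = 1 + 3 (2 + 4 x + 3 x^2),
    so R has period 13 * 3^j modulo 3^(j+1), with a first-order correction
    modulo 3^(j+2) that does not vanish at those five indices.  A Hensel
    argument then shows that 3^(j+2) | R_m^2 - 1 forces m = k modulo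
    13 * 3^(j+1) for one of them.  The only other class modulo 39 with
    9 | R_m^2 - 1 is m = 8, and it is incompatible with 53 | R_m^2 - 1.
    For n >= 53 both 53 and 3^(n/3) divide n! = R_m^2 - 1, so m is exponentially
    large in n, whereas the growth of R gives m = O(n^2).  For n < 53, n! + 1 is
    a square only for n = 4, 5, 7, and 11 and 71 are not Perrin numbers. *)

Require Import Defs.
From mathcomp Require Import all_boot.
From mathcomp Require Import ssralg ssrnum ssrint intdiv zify ring.
Import GRing.Theory.

(** * Shifts of the recurrence modulo powers of 3 *)

Definition perrin_like (f : nat -> int) : Prop :=
  forall m, f m.+3 = (f m.+1 + f m)%R.

(** Cubing the shift operator 1 + 3^(j+1) G gives 1 + 3^(j+2) G' with G' = G + 3^(j+1) G^2 +
    3^(2j+1) G^3, which is G modulo 3. In the induction step [g], [h], [k] are G, G^2, G^3 applied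
    to [f]. *)
Lemma perrin_like_shift (j : nat) (f : nat -> int) :
  perrin_like f ->
  exists g w : nat -> int,
    [/\ perrin_like g,
        forall m, f (m + 13 * 3 ^ j)%N = (f m + 3 ^+ j.+1 * g m)%R
      & forall m, g m = (2 * f m + f m.+1 + 3 * w m)%R].
Proof.
elim: j f => [|j IHj] f rec_f.
  exists (fun m => 2 * f m + 4 * f m.+1 + 3 * f m.+2)%R.
  exists (fun m => f m.+1 + f m.+2)%R.
  split=> m /=; rewrite ?expn0 ?muln1 ?expr1; last by ring.
    by rewrite !rec_f; ring.
  by rewrite !addnS addn0 !rec_f; ring.
have [g [w [rec_g fg gw]]] := IHj f rec_f.
have [h [_ [rec_h gh _]]] := IHj g rec_g.
have [k [_ [rec_k hk _]]] := IHj h rec_h.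
exists (fun m => g m + 3 ^+ j.+1 * h m + 3 ^+ (j + j).+1 * k m)%R.
exists (fun m => w m + 3 ^+ j * h m + 3 ^+ (j + j) * k m)%R.
split=> m.
- by rewrite rec_g rec_h rec_k; ring.
- have -> : (m + 13 * 3 ^ j.+1 = m + 13 * 3 ^ j + 13 * 3 ^ j + 13 * 3 ^ j)%N.
    by rewrite expnS; lia.
  rewrite !(fg, gh, hk) !exprS exprD; ring.
- by rewrite gw !exprS; ring.
Qed.

(** Modulo 3 the correction [g] is itself invariant under the shift, so [u] shifts add it [u] times,
    up to a multiple of 3^(j+2). *)
Lemma perrin_like_shift_mul (j u : nat) (f : nat -> int) (m : nat) :
  perrin_like f ->
  exists w : int,
    f (m + u * (13 * 3 ^ j))%N =
      (f m + 3 ^+ j.+1 * (u%:Z * (2 * f m + f m.+1) + 3 * w))%R.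
Proof.
move=> rec_f.
have [g [w [rec_g fg gw]]] := perrin_like_shift j _ rec_f.
have [h [_ [_ gh _]]] := perrin_like_shift j _ rec_g.
have g_mod3 v : exists z : int, g (m + v * (13 * 3 ^ j))%N = (g m + 3 * z)%R.
  elim: v => [|v [z Ez]]; first by exists 0%R; rewrite mul0n addn0; ring.
  exists (z + 3 ^+ j * h (m + v * (13 * 3 ^ j))%N)%R.
  rewrite mulSn [(13 * _ + _)%N]addnC addnA gh Ez exprS; ring.
elim: u => [|u [z Ez]]; first by exists 0%R; rewrite mul0n addn0; ring.
have [y Ey] := g_mod3 u.
exists (z + w m + y)%R.
rewrite mulSn [(13 * _ + _)%N]addnC addnA fg Ez Ey gw -[u.+1]addn1 PoszD; ring.
Qed.

(* [back_perrin m] is R_(m-29). *)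
Fixpoint back_perrin (m : nat) : int :=
  match m with
  | 0 => (-1)%R
  | 1 => 67%R
  | 2 => (-88)%R
  | ((k.+1 as k1).+2) => (back_perrin k1 + back_perrin k)%R
  end.

Lemma back_perrin_like : perrin_like back_perrin.
Proof. by []. Qed.

Lemma back_perrinE (m : nat) : back_perrin (m + 29) = (perrin m)%:Z%R.
Proof.
suff [] : [/\ back_perrin (m + 29) = Posz (perrin m),
              back_perrin (m + 29).+1 = Posz (perrin m.+1)
            & back_perrin (m + 29).+2 = Posz (perrin m.+2)] by [].
elim: m => [|m [IH0 IH1 IH2]]; first by split; vm_compute.
rewrite addSn; split=> //.
by rewrite back_perrin_like perrin_rec PoszD IH0 IH1.
Qed.

(** The indices -29, -11, -7, -2, -1 moved up by 29. *)
Definition unit_indices : seq nat := [:: 0; 18; 22; 27; 28].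

(* The zeros of R^2 - 1 at [unit_indices] are simple 3-adically. *)
Lemma unit_index_lift (j i u : nat) :
  i \in unit_indices ->
  ((3 ^+ j.+2)%R %| (back_perrin (i + u * (13 * 3 ^ j))%N ^+ 2 - 1)%R)%Z ->
  3 %| u.
Proof.
move=> i_unit.
have [w ->] := perrin_like_shift_mul j u _ i back_perrin_like.
set a := back_perrin i; set b := (2 * _ + _)%R.
have [a2 ab_coprime] : (a ^+ 2 = 1)%R /\ coprimez 3 (a * b)%R.
  by move: i_unit; rewrite /b /a !inE => /orP[|/or4P[]] /eqP->; vm_compute.
move=> /dvdzP[q Eq].
set y := (u%:Z * b + 3 * w)%R in Eq.
have X_neq0 : (3 ^+ j.+1 != 0 :> int)%R by rewrite expf_neq0.
(* This is R^2 - 1 = (a + 3^(j+1) y)^2 - a^2 divided by 3^(j+1). Modulo 3 it reads 2 a b u = 0,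
   where [a * b] is invertible. *)
have Eq' : (2 * a * y + 3 ^+ j.+1 * y ^+ 2 = 3 * q)%R.
  apply: (mulfI X_neq0).
  have -> : (3 ^+ j.+1 * (2 * a * y + 3 ^+ j.+1 * y ^+ 2) =
             (a + 3 ^+ j.+1 * y) ^+ 2 - a ^+ 2)%R by ring.
  by rewrite a2 Eq [(3 ^+ j.+2)%R]exprS; ring.
have : (3 %| (a * b * u%:Z)%R)%Z.
  apply/dvdzP; exists (a * b * u%:Z - q + 2 * a * w + 3 ^+ j * y ^+ 2)%R.
  rewrite mulrDl mulrDl mulrBl -[(q * 3)%R]mulrC -Eq' exprS /y; ring.
by rewrite Gauss_dvdzr.
Qed.

(** * Residue classes of the index *)

Definition perrin_step (q : nat) (s : nat * nat * nat) : nat * nat * nat :=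
  (s.1.2, s.2, (s.1.1 + s.1.2) %% q).

Definition perrin_init (q : nat) : nat * nat * nat := (3 %% q, 0 %% q, 2 %% q).

Lemma iter_perrin_step (q m : nat) :
  iter m (perrin_step q) (perrin_init q) =
  (perrin m %% q, perrin m.+1 %% q, perrin m.+2 %% q).
Proof.
elim: m => [//|m IH]; rewrite iterS IH /perrin_step modnDm.
by rewrite perrin_rec addnC.
Qed.

(** Once the triple of consecutive residues returns after [P] steps, everything repeats, so one
    period decides all [m]. *)
Lemma square_one_classes (q P : nat) (C : pred nat) :
  0 < P -> iter P (perrin_step q) (perrin_init q) == perrin_init q ->
  (let tr := traject (perrin_step q) (perrin_init q) P in
   all (fun k => ((nth (perrin_init q) tr k).1.1 ^ 2 %% q == 1) ==> C k)
       (iota 0 P)) ->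
  forall m, perrin m ^ 2 %% q = 1 -> C (m %% P).
Proof.
move=> P_gt0 /eqP per /allP classes m m_sq.
have perM t : iter (t * P) (perrin_step q) (perrin_init q) = perrin_init q.
  by elim: t => [//|t IH]; rewrite mulSn iterD IH.
have mP : m %% P < P by rewrite ltn_pmod.
have := classes (m %% P); rewrite mem_iota mP => /(_ isT).
rewrite nth_traject // -{1}(perM (m %/ P)) -iterD addnC -divn_eq.
by rewrite iter_perrin_step /= modnXm m_sq.
Qed.

Lemma perrin_square_one_mod39 (m : nat) :
  perrin m ^ 2 %% 9 = 1 -> perrin m ^ 2 %% 53 = 1 ->
  (m + 29) %% 39 \in unit_indices.
Proof.
move=> m9 m53.
(* 37 = 8 + 29 is the class of a non-integral 3-adic zero of R^2 - 1. *)
have : (m %% 39 + 29) %% 39 \in 37 :: unit_indices.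
  by apply: (square_one_classes 9 39 (fun k => (k + 29) %% 39 \in _)) m9;
     vm_compute.
(* 1404 = 36 * 39 is a period modulo 53, and a residue modulo 1404 determines the class modulo
   39. *)
have : (m %% 1404 + 29) %% 39 != 37.
  by apply: (square_one_classes 53 1404 (fun k => (k + 29) %% 39 != 37)) m53;
     vm_compute.
rewrite -modnDml modn_dvdm // modnDml inE.
by case: eqP.
Qed.

(** Hensel induction: the same [i] serves at every level, since each further factor 3 of [N] forces
    a factor 3 in [u]. *)
Lemma perrin_square_one_lift (j m N : nat) :
  perrin m ^ 2 = N + 1 -> 53 %| N -> 3 ^ j.+2 %| N ->
  exists2 i, i \in unit_indices & exists u, m + 29 = i + u * (13 * 3 ^ j.+1).
Proof.
move=> m_sq N53; elim: j => [|j IHj] N3.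
  exists ((m + 29) %% 39); last first.
    by exists ((m + 29) %/ 39); rewrite {1}(divn_eq (m + 29) 39) addnC.
  apply: perrin_square_one_mod39; rewrite m_sq.
    by move: N3; rewrite /dvdn -modnDml => /eqP->.
  by move: N53; rewrite /dvdn -modnDml => /eqP->.
have [|i i_unit [u Eu]] := IHj; first by rewrite (dvdn_trans _ N3) // dvdn_exp2l.
have : 3 %| u.
  apply: (unit_index_lift j.+1 i) => //.
  rewrite -Eu back_perrinE.
  have -> : ((perrin m)%:Z ^+ 2 - 1 = N%:Z)%R by rewrite -rmorphXn /=; lia.
  by rewrite dvdzE abszX.
case/dvdnP=> v Ev; exists i => //; exists v.
by rewrite Eu Ev [3 ^ j.+2]expnS; lia.
Qed.

(** * Growth against divisibility *)

Lemma perrin_ge_pow2 (m : nat) : 1 < m -> 2 ^ (m %/ 3) <= perrin m.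
Proof.
elim/ltn_ind: m => -[|[|[|[|[|m]]]]] // IH _.
rewrite perrin_rec -[m.+2.+3]addn3 divnDr // divnn expnD expn1.
have := IH m.+2 ltac:(lia) isT.
have := IH m.+3 ltac:(lia) isT.
have : 2 ^ (m.+2 %/ 3) <= 2 ^ (m.+3 %/ 3) by rewrite leq_exp2l // leq_div2r.
lia.
Qed.

Lemma fact_le_pow2 (n : nat) : n`! <= 2 ^ n ^ 2.
Proof.
elim: n => [//|n IH]; rewrite factS.
apply: leq_trans (leq_mul (ltn_expl n (isT : 1 < 2)) IH) _.
by rewrite -expnD leq_exp2l // -!mulnn; lia.
Qed.

Lemma pow3_dvd_fact (n : nat) : 3 ^ (n %/ 3) %| n`!.
Proof.
elim/ltn_ind: n => -[|[|[|n]]] // IH.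
have := bin_fact (isT : 3 <= n.+3); rewrite !subSS subn0 => <-.
rewrite -[n.+3]addn3 divnDr // divnn addn1 expnS dvdn_mull // dvdn_mul //.
by rewrite IH //; lia.
Qed.

(** The constants come from the final contradiction: 26 * 3^(k-1) <= 2 m + 58 and 2 m <= 3 n^2 + 4,
    with n <= 3 k + 2. *)
Lemma quadratic_lt_pow3 (k : nat) :
  3 < k -> 3 * (3 * k + 2) ^ 2 + 62 < 26 * 3 ^ k.-1.
Proof.
case: k => [//|k] /=; elim: k => [//|k IH]; rewrite ltnS leq_eqVlt.
case/orP=> [/eqP<-|/IH{}IH]; first by vm_compute.
rewrite [3 ^ k.+1]expnS; set p := 3 ^ k in IH *.
have step : 3 * (3 * k.+2 + 2) ^ 2 + 62 <= 3 * (3 * (3 * k.+1 + 2) ^ 2 + 62).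
  by rewrite -!mulnn; lia.
by move: step IH; set a := _ ^ 2; set b := _ ^ 2; lia.
Qed.

Lemma fact_succ_eq_perrin_square (n m : nat) :
  n`! + 1 = perrin m ^ 2 -> n < 53.
Proof.
move=> E; rewrite ltnNge; apply/negP => n_ge53.
set k := n %/ 3.
have k_ge : 17 <= k by rewrite leq_divRL //; lia.
have [|||i i_unit [u Eu]] := perrin_square_one_lift k.-2 m n`!.
- by rewrite E.
- by rewrite dvdn_fact.
- by rewrite (_ : k.-2.+2 = k) ?pow3_dvd_fact //; lia.
have i_le : i <= 28 by move: i_unit; rewrite !inE; lia.
(* The case u = 0 would give m + 29 = i <= 28: all five indices are negative before the move by
   29. *)
have m_ge : 13 * 3 ^ k.-1 <= m + 29.
  move: Eu; rewrite (_ : k.-2.+1 = k.-1); last by lia.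
  by case: u => [|u]; rewrite ?mulSn; lia.
have := quadratic_lt_pow3 k; rewrite (leq_trans _ k_ge) // => /(_ isT) k_lt.
have m_gt1 : 1 < m by lia.
have : 2 ^ (2 * (m %/ 3)) < 2 ^ (n ^ 2).+1.
  rewrite mulnC expnM.
  have : (2 ^ (m %/ 3)) ^ 2 <= perrin m ^ 2 by rewrite leq_exp2r // perrin_ge_pow2.
  move=> le_sq; apply: leq_ltn_trans le_sq _; rewrite -E expnS.
  have := fact_le_pow2 n.
  have : 2 ^ 1 <= 2 ^ n ^ 2 by rewrite leq_exp2l // expn_gt0; lia.
  by rewrite expn1; lia.
rewrite ltn_exp2l // ltnS => le_m.
have n_le : n <= 3 * k + 2 by rewrite /k; lia.
have : n ^ 2 <= (3 * k + 2) ^ 2 by rewrite leq_exp2r.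
have : m <= 3 * (m %/ 3) + 2 by lia.
lia.
Qed.

(** * Small factorials *)

Fixpoint fact_mod (q n : nat) : nat :=
  if n is k.+1 then (n * fact_mod q k) %% q else 1.

Lemma fact_modE (q n : nat) : fact_mod q n = n`! %[mod q].
Proof. by elim: n => [//|n IH]; rewrite /= modn_mod -modnMmr IH modnMmr. Qed.

Definition squares_mod (q : nat) : seq nat := [seq y ^ 2 %% q | y <- iota 0 q].

Lemma square_in_squares_mod (q x : nat) :
  0 < q -> x ^ 2 %% q \in squares_mod q.
Proof.
move=> q_gt0; rewrite -modnXm; apply/mapP; exists (x %% q) => //.
by rewrite mem_iota ltn_pmod.
Qed.

Definition fact_succ_nonresidue (q : nat) : pred nat :=
  let s := squares_mod q in fun n => (fact_mod q n + 1) %% q \notin s.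

(** For every other n below 53, n! + 1 is a quadratic nonresidue modulo one of the primes 269, 401,
    83. *)
Lemma small_brocard (n x : nat) :
  n < 53 -> n`! + 1 = x ^ 2 -> n \in [:: 4; 5; 7].
Proof.
move=> n_lt E.
have sq q : 0 < q -> ~~ fact_succ_nonresidue q n.
  move=> q_gt0; rewrite /fact_succ_nonresidue negbK -modnDml fact_modE modnDml E.
  exact: square_in_squares_mod.
have : let s1 := fact_succ_nonresidue 269 in
       let s2 := fact_succ_nonresidue 401 in
       let s3 := fact_succ_nonresidue 83 in
       all (fun k => [|| k \in [:: 4; 5; 7], s1 k, s2 k | s3 k]) (iota 0 53).
  by vm_compute.
move/allP/(_ n); rewrite mem_iota n_lt => /(_ isT).
by rewrite !(negbTE (sq _ _)) // !orbF.
Qed.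

(** R_16 = 90 already exceeds 71, so excluding 11 and 71 needs only the first 16 terms. *)
Lemma perrin_ge90 (m : nat) : 90 <= perrin (m + 16).
Proof.
elim/ltn_ind: m => -[|[|[|m]]] IH; rewrite ?leqnn //.
by rewrite !addSn perrin_rec; have := IH m ltac:(lia); rewrite -addSn; lia.
Qed.

Theorem theorem2 (n x : nat) :
  (is_perrin x /\ n`! + 1 = x ^ 2) <-> (n, x) = (4, 5).
Proof.
split=> [[[m ->] E]|[-> ->]]; last by split; [exists 5 |].
have := small_brocard _ _ (fact_succ_eq_perrin_square _ _ E) E.
have sq_inj (a b : nat) : a ^ 2 = b ^ 2 -> a = b.
  by move/eqP; rewrite eqn_exp2r // => /eqP.
have not_perrin y :
  y < 90 -> y \notin [seq perrin k | k <- iota 0 16] -> perrin m <> y.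
  move=> y_lt /mapP y_notin Em; have [m_lt|m_ge] := ltnP m 16.
    by apply: y_notin; exists m; rewrite ?mem_iota.
  by have := perrin_ge90 (m - 16); rewrite subnK // Em; lia.
rewrite !inE => /or3P[] /eqP En; move: E; rewrite {}En.
- by rewrite (_ : _ + 1 = 5 ^ 2) // => /sq_inj <-.
- by rewrite (_ : _ + 1 = 11 ^ 2) // => /sq_inj/esym/(not_perrin 11 isT isT).
- by rewrite (_ : _ + 1 = 71 ^ 2) // => /sq_inj/esym/(not_perrin 71 isT isT).
Qed.
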